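(* Let $\mathcal{G}$ be the class of all graphs $G_\ell$, $\ell\in\mathbb{N}_{\ge 1}$ (constructed as described in the context). Then $\mathcal{G}$ has coloring numbers bounded from above by a linear function; that is, there are constants $\alpha,\beta$ such that for every integer $r\geq 1$ and every $G\in\mathcal{G}$, $\mathrm{col}_r(G)\leq \alpha r+\beta$.
   Context: Coloring numbers. Given a total ordering $\sigma$ of the vertices of a graph $G$ and an integer $r\ge 1$, a vertex $y$ is $r$-reachable from a vertex $x$ (with respect to $\sigma$) if $y<_\sigma x$ and there is a path $P$ from $x$ to $y$ with at most $r$ edges such that every internal vertex $z$ of $P$ satisfies $x<_\sigma z$. The $r$-coloring number $\mathrm{col}_r(G)$ is the minimum integer $k$ such that there is a total ordering $\sigma$ of $V(G)$ with respect to which at most $k$ vertices are $r$-reachable from each vertex of $G$. Trees. In a rooted tree, $s\preceq t$ means that $s$ lies on the path from $t$ to the root, and $s\prec t$ means $s\preceq t$ and $s\ne t$. The depth of a node is the number of vertices of the path from it to the root (the root has depth $1$). The complete binary tree of depth $1$ is $K_1$; that of depth $p>1$ is obtained from two disjoint copies of the one of depth $p-1$ by adding a new vertex adjacent to their roots, which becomes the root. Blow-up. The blow-up $H$ of a complete binary tree $T$ is obtained as follows. For every node $s$ create a clique $K^s$ on 3 vertices and choose an injection $\mu_s: N_T(s)\to E(K^s)$. For every edge $st$ of $T$ with $s$ the parent of $t$, add a path $L(s,t)=u_1x_1y_1v_1$ and a path $R(s,t)=u_2x_2y_2v_2$, where $u_1,u_2$ are the endpoints of $\mu_s(t)$, $v_1,v_2$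 are the endpoints of $\mu_t(s)$ (named arbitrarily), and $x_1,x_2,y_1,y_2$ are new vertices. Set $\mathrm{tpred}(t)=\{x_1,x_2\}$ (top-predecessors), $\mathrm{bpred}(t)=\{y_1,y_2\}$ (bottom-predecessors). The top edge of $K^t$ is $\mu_t(s)$, where $s$ is the parent of $t$; the top edge of $K^r$ for the root $r$ is the only edge of $K^r$ not in the image of $\mu_r$. Intervals. Let $h(1)=3$ and $h(\ell)=2+2h(\ell-1)$ for $\ell>1$. For a set $X$ of pairs of integers, $X\oplus i=\{(x+i,x'+i):(x,x')\in X\}$. Let $\mathcal{N}_1=\{(1,3)\}$ and, for $\ell>1$, $\mathcal{N}_\ell=\{(1,h(\ell))\}\cup(\mathcal{N}_{\ell-1}\oplus 1)\cup(\mathcal{N}_{\ell-1}\oplus(h(\ell-1)+1))$. The graph $G_\ell$. Let $B_\ell$ be the complete binary tree of depth $h(\ell)$ and $H_\ell$ its blow-up. For nodes $s\prec t$ of $B_\ell$, let $\mathrm{ribs}_\ell(s,t)=\{u_1x_1,u_1x_2,u_2y_1,u_2y_2\}$, where $\{x_1,x_2\}=\mathrm{tpred}(t)$, $\{y_1,y_2\}=\mathrm{bpred}(t)$ and $u_1u_2$ is the top edge of $K^s$ (which endpoint is called $u_1$ is chosen arbitrarily). The graph $G_\ell$ is obtained from $H_\ell$ by adding the edges $\mathrm{ribs}_\ell(s,t)$ for all nodes $s\prec t$ of $B_\ell$ whose depths $i,j$ satisfy $(i,j)\in\mathcal{N}_\ell$. All choices in the construction are arbitrary; any graph obtained this way may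 be taken as $G_\ell$. *)

(* Defs.v *)
From HB Require Import structures.
From mathcomp Require Import all_boot.
From mathcomp Require Import boolp.

Set Implicit Arguments.
Unset Strict Implicit.
Unset Printing Implicit Defensive.

(* -------------------------------------------------------------------- *)
(* Finite simple graphs                                                   *)

Record sgraph := SGraph {
  vert :> finType;
  edge : rel vert;
  edge_sym : symmetric edge;
  edge_irr : irreflexive edge }.

Definition isomorphic (G H : sgraph) : Prop :=
  exists f : G -> H,
    bijective f /\ forall x y, edge (f x) (f y) = edge x y.

(* -------------------------------------------------------------------- *)
(* Coloring numbers                                                       *)

Definition total_order (T : Type) (le : rel T) : Prop :=
  [/\ reflexive le, antisymmetric le, transitive le & total le].

Definition slt (T : eqType) (le : rel T) : rel T :=
  fun x y => (x != y) && le x y.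

(* [q] lists the internal vertices of the path, which therefore has
   [(size q).+1] edges. *)
Definition reachable (G : sgraph) (le : rel G) (r : nat) (x y : G) : Prop :=
  slt le y x /\
  exists q : seq G, [/\ path (@edge G) x (rcons q y),
                        uniq (x :: rcons q y),
                        (size q).+1 <= r
                      & all (slt le x) q].

Definition col_le (r : nat) (G : sgraph) (k : nat) : Prop :=
  exists le : rel G, total_order le /\
    forall x : G, #|[set y : G | `[< reachable le r x y >]]| <= k.

Lemma col_le_ex (r : nat) (G : sgraph) : exists k, `[< col_le r G k >].
Proof.
exists #|G|; apply/asboolP.
exists (fun x y => enum_rank x <= enum_rank y); split; last first.
  by move=> x; apply: max_card.
split=> [x|x y|y x z|x y]; rewrite ?leqnn ?leq_total //.
- by rewrite -eqn_leq => /eqP/val_inj/enum_rank_inj.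
- exact: leq_trans.
Qed.

Definition col (r : nat) (G : sgraph) : nat := ex_minn (col_le_ex r G).

(* -------------------------------------------------------------------- *)
(* Complete binary trees                                                  *)

(* For [0 < p], the complete binary tree of depth [p]: a node is the word
   of length less than [p] that spells out the path leading to it from
   the root, which is the empty word. *)
Definition node (p : nat) := (p.-1).-bseq bool.

Definition depth (p : nat) (s : node p) : nat := (size s).+1.

Definition parent (p : nat) : rel (node p) :=
  fun s t => [exists b : bool, t == rcons s b :> seq bool].

Definition tadj (p : nat) : rel (node p) :=
  fun s t => parent s t || parent t s.

Definition prec (p : nat) : rel (node p) :=
  fun s t => (s != t) && prefix s t.

Definition is_root (p : nat) (s : node p) : bool := size s == 0.

Definition nonroot (p : nat) := {t : node p | ~~ is_root t}.

(* -------------------------------------------------------------------- *)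
(* The arbitrary choices of the construction                              *)

(* Every [K^s] is the complete graph on ['I_3], and its edges are the
   2-element subsets of ['I_3].  Indices 1 and 2 are represented by the
   booleans [false] and [true]. *)

Definition kedge (e : {set 'I_3}) : bool := #|e| == 2.

Definition is_top_edge (p : nat) (mu : node p -> node p -> {set 'I_3})
    (s : node p) (e : {set 'I_3}) : Prop :=
  if is_root s then kedge e /\ (forall t, tadj s t -> mu s t <> e)
  else exists2 s', parent s' s & e = mu s s'.

(* [endp s t i] is the endpoint of [mu s t] from which the path number [i]
   between [K^s] and [K^t] starts: u_1, u_2 if [s] is the parent of [t],
   and v_1, v_2 of the pair [(t, s)] if [s] is a child of [t].
   [ribp s t i] is the endpoint of the top edge of [K^s] called u_1 or u_2
   in ribs(s,t); this naming is independent of [endp] and may depend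
   on [t]. *)
Record choices (p : nat) := Choices {
  mu : node p -> node p -> {set 'I_3};
  mu_edge : forall s t, tadj s t -> kedge (mu s t);
  mu_inj : forall s, {in tadj s &, injective (mu s)};
  endp : node p -> node p -> bool -> 'I_3;
  endpE : forall s t, tadj s t ->
    [set endp s t false; endp s t true] = mu s t;
  ribp : node p -> node p -> bool -> 'I_3;
  ribpE : forall s t, prec s t ->
    is_top_edge mu s [set ribp s t false; ribp s t true] }.

(* -------------------------------------------------------------------- *)
(* Vertices and edges of the blow-up                                      *)

(* [Clique s a] is the vertex [a] of [K^s]; for a nonroot node [t],
   tpred(t) consists of the two vertices [Top t i] (x_1, x_2) and bpred(t)
   of the two vertices [Bot t i] (y_1, y_2). *)
Inductive vertex (p : nat) : Type :=
  | Clique of node p & 'I_3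
  | Top of nonroot p & bool
  | Bot of nonroot p & bool.

Section VertexFinType.
Variable p : nat.

Definition vertex_enc (v : vertex p) :
    node p * 'I_3 + (nonroot p * bool + nonroot p * bool) :=
  match v with
  | Clique s a => inl (s, a)
  | Top t i => inr (inl (t, i))
  | Bot t i => inr (inr (t, i))
  end.

Definition vertex_dec
    (v : node p * 'I_3 + (nonroot p * bool + nonroot p * bool)) : vertex p :=
  match v with
  | inl (s, a) => Clique s a
  | inr (inl (t, i)) => Top t i
  | inr (inr (t, i)) => Bot t i
  end.

Lemma vertex_encK : cancel vertex_enc vertex_dec.
Proof. by case. Qed.

HB.instance Definition _ := Finite.copy (vertex p) (can_type vertex_encK).

End VertexFinType.

(* Each edge is listed in one direction only; see [symc]. *)
Definition blowup_arc (p : nat) (c : choices p) : rel (vertex p) :=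
  fun v w => match v, w with
  | Clique s a, Clique t b => (s == t) && (a != b)
  | Clique s a, Top t i => parent s (val t) && (a == endp c s (val t) i)
  | Top t i, Bot t' j => (t == t') && (i == j)
  | Bot t i, Clique t' b =>
      (t' == val t) &&
      [exists s, parent s (val t) && (b == endp c (val t) s i)]
  | _, _ => false
  end.

(* The union of ribs(s,t) over all [s] strictly above [t] whose depths form
   a pair of [N]. *)
Definition rib_arc (p : nat) (c : choices p) (N : seq (nat * nat)) :
    rel (vertex p) :=
  fun v w => match v, w with
  | Clique s a, Top t _ =>
      [&& prec s (val t), (depth s, depth (val t)) \in N
        & a == ribp c s (val t) false]
  | Clique s a, Bot t _ =>
      [&& prec s (val t), (depth s, depth (val t)) \in N
        & a == ribp c s (val t) true]
  | _, _ => false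
  end.

Definition symc (T : Type) (e : rel T) : rel T := fun x y => e x y || e y x.

(* -------------------------------------------------------------------- *)
(* The graphs G_l                                                         *)

(* [h] and [nest] are only meaningful for a positive argument; their values
   at 0 are dummies. *)
Fixpoint h (l : nat) : nat :=
  match l with
  | 0 => 0
  | 1 => 3
  | l'.+1 => 2 + 2 * h l'
  end.

Definition shift_pairs (X : seq (nat * nat)) (i : nat) : seq (nat * nat) :=
  [seq (x.1 + i, x.2 + i) | x <- X].

Fixpoint nest (l : nat) : seq (nat * nat) :=
  match l with
  | 0 => [::]
  | 1 => [:: (1, 3)]
  | l'.+1 => (1, h l) :: shift_pairs (nest l') 1
                      ++ shift_pairs (nest l') (h l' + 1)
  end.

Section GraphG.
Variables (l : nat) (c : choices (h l)).

Definition G_edge : rel (vertex (h l)) :=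
  symc (fun v w => blowup_arc c v w || rib_arc c (nest l) v w).

Lemma G_edge_sym : symmetric G_edge.
Proof. by move=> v w; rewrite /G_edge /symc orbC. Qed.

Lemma G_edge_irr : irreflexive G_edge.
Proof. by case=> [s a|t i|t i]; rewrite /G_edge /symc /= ?eqxx. Qed.

Definition graphG : sgraph := SGraph G_edge_sym G_edge_irr.

End GraphG.

Definition classG (G : sgraph) : Prop :=
  exists l (c : choices (h l)), 1 <= l /\ isomorphic G (graphG c).

(* Main.v *)
Require Import Defs.
From mathcomp Require Import all_boot.
From mathcomp Require Import boolp zify.

Set Implicit Arguments.
Unset Strict Implicit.
Unset Printing Implicit Defensive.

(** Order the vertices by the depth of the tree node they belong to.  Edges
    join bags of comparable nodes, so a path from the bag of [t] whose internal
    vertices come later stays in the subtree of [t], and it can only end in the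
    bag of [t], in that of its parent, or, through a rib, in that of the
    ancestor at depth [i] for some [(i, j)] in [nest l] with
    [i < depth t <= j].  These intervals form a chain, and as no two intervals
    cross, a path that leaves at depth [j] must visit the right end of every
    shorter interval of the chain.  Hence at most [r] of them are usable. *)

(** * General facts on coloring numbers, walks and prefixes *)

Lemma col_le_isomorphic (r k : nat) (G H : sgraph) :
  isomorphic G H -> col_le r H k -> col_le r G k.
Proof.
case=> f [bij_f edge_f] [le [[le_refl le_anti le_trans le_total] le_k]].
have inj_f := bij_inj bij_f.
exists (fun x y => le (f x) (f y)); split.
  split=> [x|x y|y x z|x y] //; first by move/le_anti/inj_f.
  exact: le_trans.
move=> x; apply: leq_trans (le_k (f x)); rewrite -(card_imset _ inj_f).
apply/subset_leq_card/subsetP=> _ /imsetP[y + ->]; rewrite !inE.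
move=> /asboolP[lt_yx [q [q_path q_uniq q_size q_all]]]; apply/asboolP.
split; first by move: lt_yx; rewrite /slt (inj_eq inj_f).
exists (map f q); rewrite -map_rcons; split.
- by rewrite path_map (eq_path (e' := @edge G)).
- by rewrite -map_cons map_inj_uniq.
- by rewrite size_map.
- rewrite all_map; apply: sub_all q_all => z.
  by rewrite /slt /= (inj_eq inj_f).
Qed.

Lemma col_min (r k : nat) (G : sgraph) : col_le r G k -> col r G <= k.
Proof.
by move=> Gk; rewrite /col; case: ex_minnP => m _; apply; apply/asboolP.
Qed.

(** A discrete intermediate value property: [f] may fall arbitrarily along an edge, but a climb from
    below [m] cannot skip [m]. *)
Lemma path_hits (T : Type) (e : rel T) (f : T -> nat) (m : nat) (x : T)
    (q : seq T) :
  (forall v w, e v w -> f v < m -> f w <= m) ->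
  path e x q -> f x <= m <= f (last x q) -> m \in map f (x :: q).
Proof.
move=> e_m; elim: q x => [|y q IHq] x /=.
  by move=> _; rewrite inE eqn_leq andbC.
case/andP=> exy q_path /andP[le_fx_m m_last]; rewrite inE.
case: eqVneq => //= ne_m_fx; apply: IHq => //; rewrite m_last andbT.
by apply: e_m exy _; rewrite ltn_neqAle eq_sym ne_m_fx.
Qed.

Lemma prefix_comparable (T : eqType) (s1 s2 s : seq T) :
  prefix s1 s -> prefix s2 s -> size s1 <= size s2 -> prefix s1 s2.
Proof.
rewrite !prefixE => /eqP def_s1 /eqP def_s2 le_s12.
by rewrite -[X in take _ X]def_s2 take_takel // def_s1.
Qed.

Lemma prefix_size_eq (T : eqType) (s1 s2 : seq T) :
  prefix s1 s2 -> size s2 <= size s1 -> s1 = s2.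
Proof. by rewrite prefixE => /eqP {2}<- /take_oversize ->. Qed.

(** * The nested intervals *)

Lemma hS (l : nat) : 0 < l -> h l.+1 = 2 + 2 * h l.
Proof. by case: l. Qed.

Lemma nestS (l : nat) :
  0 < l ->
  nest l.+1 = (1, 2 + 2 * h l) :: shift_pairs (nest l) 1
                ++ shift_pairs (nest l) (h l + 1).
Proof. by case: l. Qed.

Lemma nest_bound (l i j : nat) : (i, j) \in nest l -> 1 <= i /\ i < j <= h l.
Proof.
elim: l i j => // l IHl i j.
have [->|l_gt0] := posnP l; first by rewrite inE => /eqP[-> ->].
rewrite nestS // hS // inE mem_cat => /or3P[/eqP[-> ->]||]; first lia.
all: by case/mapP=> -[a b] /IHl /= bounds [-> ->]; lia.
Qed.

(** By [nest_bound], the two shifted copies occupy disjoint ranges of depths, both strictly inside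
    the outer interval. So only pairs from the same copy need the induction hypothesis. *)
Lemma nest_laminar (l i j a b : nat) :
  (i, j) \in nest l -> (a, b) \in nest l ->
  (j = b -> i = a) /\ ~~ [&& i < a, a < j & j < b].
Proof.
elim: l i j a b => // l IHl i j a b.
have [->|l_gt0] := posnP l; first by rewrite !inE => /eqP[-> ->] /eqP[-> ->].
rewrite nestS // !inE !mem_cat.
case/or3P=> [/eqP[-> ->]
  |/mapP[[i' j'] N1 /= [-> ->]]
  |/mapP[[i' j'] N1 /= [-> ->]]];
case/or3P=> [/eqP[-> ->]
  |/mapP[[a' b'] N2 /= [-> ->]]
  |/mapP[[a' b'] N2 /= [-> ->]]];
  try have := nest_bound N1; try have := nest_bound N2;
  try have [] := IHl _ _ _ _ N1 N2; lia.
Qed.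

(** * Bags, the order by depth, and subtrees *)

Section Reachability.
Variables (l : nat) (c : choices (h l)).
Let G := graphG c.

(** The vertices subdividing the edge from a node to its parent go to the child, so that every edge,
    ribs included, joins bags of comparable nodes. *)
Definition bag (v : vertex (h l)) : node (h l) :=
  match v with
  | Clique s _ => s
  | Top t _ => val t
  | Bot t _ => val t
  end.

Definition position (v : vertex (h l)) : 'I_3 + (bool + bool) :=
  match v with
  | Clique _ a => inl a
  | Top _ i => inr (inl i)
  | Bot _ i => inr (inr i)
  end.

Lemma bag_position_inj : injective (fun v => (bag v, position v)).
Proof.
move=> [s a|t i|t i] [s' a'|t' i'|t' i'] //= [].
- by move=> -> ->.
- by move=> /val_inj -> ->.
- by move=> /val_inj -> ->.
Qed.

Definition level (v : vertex (h l)) : nat := depth (bag v).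

Lemma prefix_level (v w : vertex (h l)) :
  prefix (bag v) (bag w) -> level v <= level w.
Proof. exact: size_prefix. Qed.

Definition level_le (v w : vertex (h l)) : bool :=
  (level v < level w)
  || (level v == level w) && (enum_rank v <= enum_rank w).

Lemma level_le_total_order : total_order level_le.
Proof.
split=> [v|v w|w v u|v w]; rewrite /level_le.
- by rewrite eqxx leqnn orbT.
- move=> vw; apply/enum_rank_inj/ord_inj; move: vw.
  move: (enum_rank v : nat) (enum_rank w : nat) => m n; lia.
- lia.
- lia.
Qed.

Lemma level_leW (v w : vertex (h l)) : level_le v w -> level v <= level w.
Proof. rewrite /level_le; lia. Qed.

Definition short_or_rib (v w : vertex (h l)) : Prop :=
  prefix (bag v) (bag w) /\
  (level w <= (level v).+1 \/ (level v, level w) \in nest l).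

Lemma short_or_rib_edge (v w : G) :
  edge v w -> short_or_rib v w \/ short_or_rib w v.
Proof.
(* Every arc is listed from the upper bag to the lower one, or stays within one bag. *)
suff arcP (v' w' : G) : blowup_arc c v' w' || rib_arc c (nest l) v' w' ->
    short_or_rib v' w'.
  by case/orP=> /arcP; [left | right].
have parentP (s t : node (h l)) : parent s t ->
    prefix s t /\ depth t <= (depth s).+1.
  by case/existsP=> b /eqP def_t; rewrite /depth def_t size_rcons prefix_rcons.
rewrite /short_or_rib /level.
case: v' w' => [s a|t i|t i] [s' a'|t' i'|t' i'] //=; rewrite ?orbF.
- by case/andP=> /eqP -> _; rewrite prefix_refl; split=> //; left.
- case/orP=> [/andP[/parentP[-> ?] _]|/and3P[/andP[_ ->] ? _]].
    by split=> //; left.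
  by split=> //; right.
- by case/and3P=> /andP[_ ->] ? _; split=> //; right.
- by case/andP=> /eqP -> _; rewrite prefix_refl; split=> //; left.
- by case/andP=> /eqP -> _; rewrite prefix_refl; split=> //; left.
Qed.

(** Adjacent bags are comparable, so the subtree of [t] can only be left towards a proper ancestor
    of [t], which has smaller depth. *)
Lemma edge_subtree (t : node (h l)) (v w : G) :
  edge v w -> prefix t (bag v) -> depth t <= level w -> prefix t (bag w).
Proof.
move=> /short_or_rib_edge[] [vw _] tv tw; first exact: prefix_trans tv vw.
exact: prefix_comparable tv vw _.
Qed.

Lemma path_subtree (t : node (h l)) (v : G) (q : seq G) :
  path (@edge G) v q -> prefix t (bag v) ->
  all (fun w => depth t <= level w) q -> prefix t (bag (last v q)).
Proof.
elim: q v => [|w q IHq] v //= /andP[vw q_path] tv /andP[tw tq].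
exact: IHq q_path (edge_subtree vw tv tw) tq.
Qed.

(** * Intervals through which a walk can leave a subtree *)

(** The walk stops at the right end of the interval; the strict bound on [size q] leaves one edge
    for the rib up to the left end. *)
Definition escapes (r : nat) (x : G) (ij : nat * nat) : Prop :=
  exists q : seq G,
    [/\ path (@edge G) x q, all (fun w => level x <= level w) q,
        size q < r & level (last x q) = ij.2].

Definition escaping (r : nat) (x : G) : seq (nat * nat) :=
  undup [seq ij <- nest l | (ij.1 < level x <= ij.2) && `[< escapes r x ij >]].

(** A rib from [v] down past depth [ij.2] would start strictly inside [ij] and end beyond it, so its
    interval would cross [ij]; a short edge descends one level at most. *)
Lemma edge_no_jump (x : G) (ij : nat * nat) (v w : G) :
  ij \in nest l -> ij.1 < level x ->
  edge v w -> level x <= level v -> level v < ij.2 -> level w <= ij.2.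
Proof.
case: ij => i j /= Nij lt_ix /short_or_rib_edge[] [/prefix_level + short_or_N].
  case: short_or_N => [|N _]; first lia.
  by have [_] := nest_laminar Nij N; lia.
lia.
Qed.

Lemma mem_escaping (r : nat) (x : G) (ij : nat * nat) :
  reflect [/\ ij \in nest l, ij.1 < level x <= ij.2 & escapes r x ij]
    (ij \in escaping r x).
Proof.
rewrite mem_undup mem_filter.
apply: (iffP andP) => [[/andP[? /asboolP ?] ?]|[? ? ?]] //.
by split=> //; apply/andP; split=> //; apply/asboolP.
Qed.

(** The walk for the interval with the largest right end has at most [r] vertices and meets the
    right ends of all the others; distinct intervals have distinct right ends. *)
Lemma size_escaping (r : nat) (x : G) : size (escaping r x) <= r.
Proof.
have inj_snd : {in escaping r x &, injective snd}.
  move=> [i j] [i' j'] /mem_escaping[N _ _] /mem_escaping[N' _ _] /= def_j.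
  by have [/(_ def_j) -> _] := nest_laminar N N'; rewrite def_j.
have [-> //|E_neq0] := eqVneq (escaping r x) [::].
have [ij ijE ij_max] : exists2 ij, ij \in escaping r x &
    forall ij', ij' \in escaping r x -> ij'.2 <= ij.2.
  pose is_end m := has (fun ij => ij.2 == m) (escaping r x).
  have end_ex : exists m, is_end m.
    case: (escaping r x) E_neq0 @is_end => // ij E _.
    by exists ij.2; rewrite /= eqxx.
  have end_le m : is_end m -> m <= h l.
    by case/hasP=> -[i j] /mem_escaping[/nest_bound[_ /andP[_ ?]] _ _] /eqP <-.
  have [m /hasP[ij ijE /eqP def_m] m_max] := ex_maxnP end_ex end_le.
  exists ij => // ij' ij'E; rewrite def_m m_max //.
  by apply/hasP; exists ij'.
have [_ _ [q [q_path q_level q_size q_last]]] := mem_escaping _ _ _ ijE.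
pose high (w : G) := level x <= level w.
have high_xq : all high (x :: q) by rewrite /= {1}/high leqnn.
(* [edge_no_jump] needs the source of each edge to be at least as deep as [x], so the relation
   passed to [path_hits] records this. *)
have path_high : path (fun v w : G => edge v w && high v) x q.
  by apply: (sub_in_path _ high_xq q_path) => v w v_high _ /= ->.
rewrite -(size_map snd); apply: leq_trans (_ : size (map level (x :: q)) <= r).
  apply: uniq_leq_size; first by rewrite map_inj_in_uniq ?undup_uniq.
  move=> _ /mapP[ij' ij'E ->].
  have [N' /andP[lt_ix le_xj] _] := mem_escaping _ _ _ ij'E.
  apply: path_hits path_high _; last by rewrite le_xj q_last ij_max.
  by move=> v w /andP[vw v_high]; apply: edge_no_jump N' lt_ix vw v_high.
by rewrite size_map.
Qed.

(** * Counting the reachable vertices *)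

(** The bag of [x], that of its parent, and the upper ends of usable ribs. If [x] lies in the root
    bag, the second entry is 0, the depth of no node. *)
Definition reach_depths (r : nat) (x : G) : seq nat :=
  [:: level x, (level x).-1 & map fst (escaping r x)].

Lemma reachable_bag (r : nat) (x y : G) :
  @reachable G level_le r x y ->
  prefix (bag y) (bag x) /\ level y \in reach_depths r x.
Proof.
case=> /andP[_ /level_leW le_yx] [q [xqy_path _ q_size q_gt]].
have q_level : all (fun w => level x <= level w) q.
  by apply: sub_all q_gt => w /andP[_ /level_leW].
move: xqy_path; rewrite rcons_path => /andP[q_path].
set z := last x q => zy.
have xz : prefix (bag x) (bag z).
  exact: path_subtree q_path (prefix_refl _) q_level.
have le_xz := prefix_level xz.
have yx : prefix (bag y) (bag x).
  have yz : prefix (bag y) (bag z) \/ prefix (bag z) (bag y).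
    by have [[? _]|[? _]] := short_or_rib_edge zy; [right | left].
  (* If the bag of [y] is below that of [z], it is also below that of [x], hence equal to it because
     [y] is no deeper than [x]. *)
  case: yz => [yz|zy']; first exact: prefix_comparable yz xz _.
  by rewrite (prefix_size_eq (prefix_trans xz zy')) // prefix_refl.
split=> //; rewrite /reach_depths !inE.
have [//|ne_yx /=] := eqVneq (level y) (level x).
have [//|ne_yx' /=] := eqVneq (level y) (level x).-1.
(* Now [y] is at least two levels above [x], hence above [z], so the last edge must be a rib and [q]
   witnesses the escape. *)
have {zy} [[/prefix_level ? _]|[_ [|yzN]]] := short_or_rib_edge zy; try lia.
apply/mapP; exists (level y, level z) => //.
apply/mem_escaping; split=> //=; first lia.
by exists q.
Qed.

(** The ancestors of [t] form a chain, so each is determined by its depth. *)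
Lemma card_prefixes (t : node (h l)) (D : seq nat) :
  #|[set s : node (h l) | prefix s t & depth s \in D]| <= size D.
Proof.
rewrite cardE -(size_map (@depth _)); apply: uniq_leq_size.
  rewrite map_inj_in_uniq ?enum_uniq // => s1 s2.
  rewrite !mem_enum !inE => /andP[s1_t _] /andP[s2_t _] [s12].
  apply/val_inj/(@prefix_size_eq bool); last by rewrite s12.
  by apply: prefix_comparable s1_t s2_t _; rewrite s12.
by move=> _ /mapP[s + ->]; rewrite mem_enum inE => /andP[].
Qed.

(** There are at most [r + 2] possible bags, each with at most 3 + 2 + 2 = 7 positions. *)
Lemma card_reachable (r : nat) (x : G) :
  #|[set y : G | `[< @reachable G level_le r x y >]]| <= 7 * r + 14.
Proof.
set S := [set y | _]; pose f (y : G) := (bag y, position y).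
rewrite -(card_imset S bag_position_inj).
pose A :=
  [set s : node (h l) | prefix s (bag x) & depth s \in reach_depths r x].
have /subset_leq_card : [set f y | y in S] \subset setX A setT.
  apply/subsetP=> _ /imsetP[y + ->]; rewrite !inE andbT.
  by move=> /asboolP/reachable_bag/andP.
rewrite cardsX cardsT !card_sum card_ord card_bool => /leq_trans; apply.
have := card_prefixes (bag x) (reach_depths r x); rewrite -/A /= size_map.
have := size_escaping r x; lia.
Qed.

End Reachability.

Theorem theorem1p8 :
  exists alpha beta : nat,
    forall (r : nat) (G : sgraph),
      1 <= r -> classG G -> col r G <= alpha * r + beta.
Proof.
exists 7, 14 => r G _ [l [c [_ G_iso]]].
apply/col_min/(col_le_isomorphic G_iso).
exists (@level_le l); split; first exact: level_le_total_order.
exact: card_reachable.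
Qed.
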